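(* Let $G$ be a (connected) distance-hereditary graph and let $T_{\mathcal{F}}$ be its minimal split-decomposition tree. Then $G$ contains an induced subgraph isomorphic to the path $P_4$ if and only if there exists an s-leaf-path in $T_{\mathcal{F}}$.
   Context: A graph is distance-hereditary if the distance between any two vertices in any connected induced subgraph equals their distance in the graph. Split decomposition: for a connected graph $G=(V,E)$, a split is a partition $\{V_1,V_2\}$ of $V$ with $|V_1|,|V_2|\ge 2$ such that every vertex of $N_G(V_1)$ is adjacent to every vertex of $N_G(V_2)$ (where $N_G(A)=\bigcup_{a\in A}N_G(a)\setminus A$). Decomposing along it replaces $G$ by the disjoint union of $G[V_1]$ and $G[V_2]$ plus a marked edge $v_1v_2$ between two new marked vertices, $v_1$ adjacent to all of $N_G(V_2)$ and $v_2$ adjacent to all of $N_G(V_1)$; deleting marked edges gives split components, and one recurses. Adding a new pendant vertex $a'$ adjacent to each non-marked vertex $a$ yields a graph-labelled tree $T_{\mathcal{F}}$ (a tree $T$ whose internal nodes are replaced by the split components, the family $\mathcal{F}$). Edges inside split components are $\mathcal{F}$-edges; the remaining edges (marked edges and pendant edges) are $T$-edges. An alternated path is a path in $T_{\mathcal{F}}$ alternating between $T$-edges and $\mathcal{F}$-edges. The accessibility graph has as vertices the pendant vertices of $T_{\mathcal{F}}$, two being adjacent iff they are joined by an alternated path. The minimal split-decomposition tree of $G$ is the unique split-decomposition tree such that: its accessibility graph is isomorphic to $G$; every split component is a clique, a star, or a prime graph (one with no split); every split component has at least three vertices; no marked edge joins two clique components; and no marked edge joins the center of a star component to a leaf of another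 star component. A leaf of a star component is called an s-leaf. An s-leaf-path is an alternated path in $T_{\mathcal{F}}$ whose endpoints are s-leaves of two (distinct) star components and which contains no edge of either of these two star components. *)

(* Defs.v *)
From mathcomp Require Import all_boot.

Set Implicit Arguments.
Unset Strict Implicit.
Unset Printing Implicit Defensive.

Record graph := Graph {
  vert :> finType;
  edge : rel vert;
  edge_sym : symmetric edge;
  edge_irr : irreflexive edge }.

Section Induced.
Variables (G : graph) (S : {set G}).

Definition induced_edge : rel {x : G | x \in S} :=
  fun x y => edge (val x) (val y).

Lemma induced_edge_sym : symmetric induced_edge.
Proof. by move=> x y; apply: edge_sym. Qed.

Lemma induced_edge_irr : irreflexive induced_edge.
Proof. by move=> x; apply: edge_irr. Qed.

Definition induced : graph := Graph induced_edge_sym induced_edge_irr.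
End Induced.

Section PathGraph.
Variable n : nat.

Definition path_edge : rel 'I_n :=
  fun i j => (i.+1 == j :> nat) || (j.+1 == i :> nat).

Lemma path_edge_sym : symmetric path_edge.
Proof. by move=> i j; apply: orbC. Qed.

Lemma path_edge_irr : irreflexive path_edge.
Proof. by move=> i; rewrite /path_edge orbb gtn_eqF. Qed.

(* The path on n vertices. *)
Definition path_graph : graph := Graph path_edge_sym path_edge_irr.
End PathGraph.

Definition graph_iso (G H : graph) : Prop :=
  exists2 f : G -> H, bijective f & forall x y, edge (f x) (f y) = edge x y.

Definition has_induced (G H : graph) : Prop :=
  exists S : {set G}, graph_iso (induced S) H.

Definition connected (G : graph) : Prop :=
  forall x y : G, connect (@edge G) x y.

(* The least length of a walk from x to y.  A shortest walk has length less
   than #|G|; the value is #|G| if y is not reachable from x. *)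
Definition dist (G : graph) (x y : G) : nat :=
  find (fun k => [exists p : k.-tuple G, path (@edge G) x p && (last x p == y)])
       (iota 0 #|G|).

Definition distance_hereditary (G : graph) : Prop :=
  forall S : {set G}, connected (induced S) ->
  forall x y : induced S, dist x y = dist (val x) (val y).

Section InducedProperties.
Variable G : graph.
Implicit Types (A B C : {set G}) (x c : G).

(* N_H(A) for H = G[C]. *)
Definition nbh C A : {set G} :=
  [set y in C :\: A | [exists a in A, edge a y]].

(* {A, B} is a split of G[C]. *)
Definition is_split C A B : bool :=
  [&& A :|: B == C, [disjoint A & B], 2 <= #|A|, 2 <= #|B|
    & [forall a in nbh C A, forall b in nbh C B, edge a b]].

Definition is_prime C : bool :=
  [forall A : {set G}, forall B : {set G}, ~~ is_split C A B].

Definition is_clique C : bool :=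
  [forall x in C, forall y in C, (x != y) ==> edge x y].

(* The center is unique, and C is not a clique, once C has three vertices. *)
Definition star_center C c : bool :=
  (c \in C) && [forall x in C, forall y in C, edge x y == ((x == c) != (y == c))].

Definition is_star C : bool := [exists c, star_center C c].

Definition star_leaf C x : bool :=
  (x \in C) && [exists c, star_center C c && (x != c)].

Definition component x : {set G} := [set y | connect (@edge G) x y].
End InducedProperties.

(* A graph with marked edges.  The edges of the underlying graph are the
   unmarked ones, so that its connected components are the split components. *)
Record mgraph := MGraph {
  fgraph :> graph;
  medge : rel fgraph;
  medge_sym : symmetric medge;
  medge_irr : irreflexive medge }.

Section Unmarked.
Variable G : graph.

Definition no_edge : rel G := fun _ _ => false.

Lemma no_edge_sym : symmetric no_edge. Proof. by []. Qed.
Lemma no_edge_irr : irreflexive no_edge. Proof. by []. Qed.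

Definition unmarked : mgraph := MGraph no_edge_sym no_edge_irr.
End Unmarked.

(* Decomposition of D along the split {A, B} of its split component A :|: B:
   the new marked vertices are v1 = inr true, on the side of A, and
   v2 = inr false, on the side of B. *)
Section Decompose.
Variables (D : mgraph) (A B : {set D}).

Definition dec_fedge : rel (D + bool)%type := fun u v =>
  match u, v with
  | inl x, inl y =>
      edge x y && ~~ ((x \in A) && (y \in B) || (x \in B) && (y \in A))
  | inl x, inr b | inr b, inl x =>
      x \in if b then nbh (A :|: B) B else nbh (A :|: B) A
  | inr _, inr _ => false
  end.

Definition dec_medge : rel (D + bool)%type := fun u v =>
  match u, v with
  | inl x, inl y => medge x y
  | inr b, inr c => b != c
  | _, _ => false
  end.

Lemma dec_fedge_sym : symmetric dec_fedge.
Proof.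
case=> [x|b] [y|c] //=; rewrite edge_sym orbC.
by rewrite [(y \in A) && _]andbC [(y \in B) && _]andbC.
Qed.

Lemma dec_fedge_irr : irreflexive dec_fedge.
Proof. by case=> [x|b] //=; rewrite edge_irr. Qed.

Lemma dec_medge_sym : symmetric dec_medge.
Proof. by case=> [x|b] [y|c] //=; [apply: medge_sym | rewrite eq_sym]. Qed.

Lemma dec_medge_irr : irreflexive dec_medge.
Proof. by case=> [x|b] /=; [apply: medge_irr | rewrite eqxx]. Qed.

Definition decompose : mgraph :=
  @MGraph (Graph dec_fedge_sym dec_fedge_irr) dec_medge
          dec_medge_sym dec_medge_irr.
End Decompose.

Inductive split_decomposition (G : graph) : mgraph -> Prop :=
| split_dec_start : split_decomposition G (unmarked G)
| split_dec_step (D : mgraph) (x : D) (A B : {set D}) :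
    split_decomposition G D -> is_split (component x) A B ->
    split_decomposition G (decompose A B).

Section GraphLabelledTree.
Variable D : mgraph.

Definition marked (x : D) : bool := [exists y, medge x y].

Definition pendant : finType := {x : D | ~~ marked x}.

(* The vertices of the graph-labelled tree: inr a is the pendant vertex
   attached to the non-marked vertex val a. *)
Definition tf_vert : finType := (D + pendant)%type.

Definition tf_tedge : rel tf_vert := fun u v =>
  match u, v with
  | inl x, inl y => medge x y
  | inl x, inr a | inr a, inl x => x == val a
  | inr _, inr _ => false
  end.

Definition tf_fedge : rel tf_vert := fun u v =>
  match u, v with
  | inl x, inl y => edge x y
  | _, _ => false
  end.

(* u :: p is a walk whose edges are alternately T-edges and F-edges, the first
   one being a T-edge iff b. *)
Fixpoint alternating (b : bool) (u : tf_vert) (p : seq tf_vert) : bool :=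
  if p is v :: q then
    (if b then tf_tedge u v else tf_fedge u v) && alternating (~~ b) v q
  else true.

Definition alternated_path (u : tf_vert) (p : seq tf_vert) : bool :=
  uniq (u :: p) && (alternating true u p || alternating false u p).

(* The bound on the length is that of any path, whose vertices are distinct. *)
Definition accessible : rel pendant := fun a b =>
  (a != b) && [exists n : 'I_#|tf_vert|, exists p : n.-tuple tf_vert,
    alternated_path (inr a) p && (last (inr a) p == inr b)].

Lemma tf_tedge_sym : symmetric tf_tedge.
Proof. by case=> [x|a] [y|b] //=; apply: medge_sym. Qed.

Lemma tf_fedge_sym : symmetric tf_fedge.
Proof. by case=> [x|a] [y|b] //=; apply: edge_sym. Qed.

Lemma alternating_rcons b u p v :
  alternating b u (rcons p v) = alternating b u p &&
    (if b (+) odd (size p) then tf_tedge (last u p) v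
     else tf_fedge (last u p) v).
Proof.
elim: p b u => [|w p IHp] b u /=; first by rewrite addbF andbT.
by rewrite IHp andbA addbN addNb.
Qed.

Lemma alternating_rev b u p :
  alternating b u p ->
  alternating (b (+) ~~ odd (size p)) (last u p) (rev (belast u p)).
Proof.
elim: p b u => [|w p IHp] b u //= /andP[uw /IHp altp].
rewrite rev_cons alternating_rcons size_rev size_belast negbK.
have -> : last (last w p) (rev (belast w p)) = w.
  by case: (p) => [|z q] //=; rewrite rev_cons last_rcons.
have -> : b (+) odd (size p) (+) odd (size p) = b by rewrite addbK.
rewrite addNb addbN negbK in altp; rewrite altp /=.
by case: b uw {altp}; rewrite 1?tf_tedge_sym 1?tf_fedge_sym.
Qed.

Lemma alternated_path_rev u p :
  alternated_path u p -> alternated_path (last u p) (rev (belast u p)).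
Proof.
case/andP=> uniq_p altp; apply/andP; split.
  by rewrite -rev_rcons -lastI rev_uniq.
case/orP: altp => /alternating_rev; case: (_ (+) _) => -> //; exact: orbT.
Qed.

Lemma accessible_sym : symmetric accessible.
Proof.
suff acc_rev a b : accessible a b -> accessible b a.
  by move=> a b; apply/idP/idP; apply: acc_rev.
case/andP=> ab /existsP[n /existsP[p /andP[altp /eqP pb]]].
rewrite /accessible eq_sym ab; apply/existsP; exists n.
have sz : size (rev (belast (inr a : tf_vert) p)) == n.
  by rewrite size_rev size_belast size_tuple.
apply/existsP; exists (Tuple sz); rewrite /= -pb alternated_path_rev //=.
case: (tval p) pb => [[ba]|z q _] /=; first by rewrite eqxx.
by rewrite rev_cons last_rcons.
Qed.

Lemma accessible_irr : irreflexive accessible.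
Proof. by move=> a; rewrite /accessible eqxx. Qed.

Definition accessibility_graph : graph := Graph accessible_sym accessible_irr.

Definition s_leaf (x : D) : bool := star_leaf (component x) x.

Definition edge_within (C : {set D}) (uv : tf_vert * tf_vert) : bool :=
  match uv with
  | (inl x, inl y) => [&& x \in C, y \in C & edge x y]
  | _ => false
  end.

(* zip (u :: p) p lists the edges of the path u :: p. *)
Definition s_leaf_path (x y : D) (p : seq tf_vert) : Prop :=
  [/\ alternated_path (inl x) p /\ last (inl x) p = inl y,
      s_leaf x, s_leaf y, component x != component y
    & forall uv, uv \in zip (inl x :: p) p ->
        ~~ edge_within (component x) uv /\ ~~ edge_within (component y) uv].

Definition has_s_leaf_path : Prop := exists x y p, s_leaf_path x y p.
End GraphLabelledTree.

Record minimal_split_decomposition (G : graph) (D : mgraph) : Prop := {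
  min_split_dec : split_decomposition G D;
  min_access : graph_iso (accessibility_graph D) G;
  min_types : forall x : D, [|| is_clique (component x),
    is_star (component x) | is_prime (component x)];
  min_card : forall x : D, 3 <= #|component x|;
  min_clique : forall x y : D, medge x y ->
    ~~ (is_clique (component x) && is_clique (component y));
  min_star : forall x y : D, medge x y ->
    ~~ (star_center (component x) x && star_leaf (component y) y) }.

(* Main.v *)
(* The tree structure is encoded by projections: for a vertex x of the
   decomposition, r x maps every vertex y to the vertex of the component of x
   through which y is reached in the tree.  Two pendant vertices are
   accessible from each other iff in every component their projections are
   equal or adjacent.

   If a - b - c - d is an induced P4 of the accessibility graph, then a and c
   have distinct non-adjacent projections in some component q1, and b and d in
   some component q2.  Both components are stars, b projects to the center of
   q1 and c to the center of q2.  Comparing q1 and q2 (and a component that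
   separates a from d) one finds that q1 and q2 face each other through
   s-leaves, and the walk from b to c contains an s-leaf-path between them.
   Conversely, an s-leaf-path from x to y extends to an induced P4 on
   representatives of a second leaf and of the center of the star of x, and of
   the center and of a second leaf of the star of y.

   Distance-heredity only serves to exclude prime components.  Let x have
   minimum degree in a component with at least three vertices, and let R be a
   component of what remains after removing x and its neighbours.  All
   vertices of R with a neighbour in N(x) have the same neighbours there, so R
   and its complement form a split if R has two vertices.  If R = {w}, then
   N(w) = N(x) by minimality and {x, w} yields a split or a star.  If there is
   no R, the component is a clique. *)
Require Import Defs.
From mathcomp Require Import all_boot.

Set Implicit Arguments.
Unset Strict Implicit.
Unset Printing Implicit Defensive.

(** * Alternating walks in a tree of components *)

Lemma connect_invariant (V : finType) (e : rel V) (P : V -> Prop) x y :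
  connect e x y -> P x -> (forall u v, e u v -> P u -> P v) -> P y.
Proof.
move=> /connectP[p + ->] Px cl; elim: p x Px => //= z p IHp x Px /andP[xz].
exact: IHp (cl _ _ xz Px).
Qed.

(* For T = marked edges and F = edges of the split components: r x retracts V
   onto the F-component of x and is constant along all edges outside it, so
   that the F-components are joined by T in the shape of a tree. *)
Record tree_like (V : finType) (T F : rel V) (r : V -> V -> V) : Prop := TreeLike {
  T_sym : symmetric T;
  F_sym : symmetric F;
  T_irr : irreflexive T;
  F_irr : irreflexive F;
  T_matching : forall x y z, T x y -> T x z -> y = z;
  TF_connect : forall x y, connect (fun u v => T u v || F u v) x y;
  proj_id : forall x y, connect F x y -> r x y = y;
  proj_T : forall x y z, T y z -> r x y = r x z;
  proj_F : forall x y z, F y z -> ~~ connect F x y -> r x y = r x z }.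

Section AlternatingWalk.
Variables (V : finType) (T F : rel V).

Fixpoint alt_walk (b : bool) (u : V) (p : seq V) : bool :=
  if p is v :: q then (if b then T u v else F u v) && alt_walk (~~ b) v q
  else true.

(** Odd length makes the last edge a T-edge like the first, so that two such walks can be joined by
    an F-edge. *)
Definition TT_walk x p y := [&& alt_walk true x p, odd (size p) & last x p == y].

Lemma alt_walk_cat b u p q :
  alt_walk b u (p ++ q) =
  alt_walk b u p && alt_walk (b (+) odd (size p)) (last u p) q.
Proof.
elim: p b u => [|v p IHp] b u /=; first by rewrite addbF.
by rewrite IHp andbA addNb addbN.
Qed.

Lemma TT_walk_cat x p y z q t :
  TT_walk x p y -> F y z -> TT_walk z q t -> TT_walk x (p ++ z :: q) t.
Proof.
case/and3P=> wp op /eqP lp yz /and3P[wq oq lq]; apply/and3P; split.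
- by rewrite alt_walk_cat wp op lp /= yz.
- by rewrite size_cat oddD op /= oq.
- by rewrite last_cat.
Qed.

Hypotheses (Tsym : symmetric T) (Fsym : symmetric F).

Lemma TT_walk_rev x p y :
  TT_walk x p y -> TT_walk y (rev (belast x p)) x.
Proof.
case/and3P=> wp op /eqP <-{y}; apply/and3P; split; first 1 last.
- by rewrite size_rev size_belast.
- by case: (p) op => //= z q _; rewrite rev_cons last_rcons.
(* Generalised over the kind of the first edge: [b (+) ~~ odd (size p)] is the kind of the last
   edge, with which the reversed walk begins. *)
suff H b : alt_walk b x p ->
    alt_walk (b (+) ~~ odd (size p)) (last x p) (rev (belast x p)).
  by move/H: wp; rewrite op.
elim: p b x {wp op} => [|w p IHp] b u //= /andP[uw /IHp altp].
rewrite rev_cons -cats1 alt_walk_cat size_rev size_belast /=.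
have -> : last (last w p) (rev (belast w p)) = w.
  by case: (p) => [|z q] //=; rewrite rev_cons last_rcons.
rewrite negbK addbK andbT addNb addbN negbK in altp *.
by rewrite altp; case: b uw {altp}; rewrite 1?Tsym 1?Fsym.
Qed.

End AlternatingWalk.

Section TreeLike.
Variables (V : finType) (T F : rel V) (r : V -> V -> V).
Hypothesis tl : tree_like T F r.

Local Notation "x ~~> y" := (connect F x y) (at level 70).

Definition eq_or_adj x y := (x == y) || F x y.

Lemma F_connect_sym x y : (x ~~> y) = (y ~~> x).
Proof. exact: (sym_connect_sym (F_sym tl)). Qed.

Lemma eq_or_adj_sym x y : eq_or_adj x y = eq_or_adj y x.
Proof. by rewrite /eq_or_adj eq_sym (F_sym tl). Qed.

Lemma proj_self x : r x x = x.
Proof. exact: (proj_id tl) (connect0 _ _). Qed.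

(** Along a walk from [x] to [y] the projection starts at [x] and changes only while the walk is
    inside the F-component of [x], where it is the current vertex of the walk. *)
Lemma connect_projr x y : x ~~> r x y.
Proof.
apply: (connect_invariant (P := fun u => x ~~> r x u) (TF_connect tl x y)) => [|u v uv xu].
  by rewrite proj_self.
case/orP: uv => [/(proj_T tl)<- //|uv].
have [xu'|nxu] := boolP (x ~~> u); last by rewrite -(proj_F tl uv nxu).
have xv := connect_trans xu' (connect1 uv).
by rewrite (proj_id tl xv).
Qed.

Lemma eq_proj x x' y : x ~~> x' -> r x y = r x' y.
Proof.
move=> xx'.
apply: (connect_invariant (P := fun u => r x u = r x' u) (TF_connect tl x y)) => [|u v uv e].
  by rewrite proj_self (proj_id tl) // F_connect_sym.
case/orP: uv => [uv|uv]; first by rewrite -!(proj_T tl _ uv).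
have E z : (x' ~~> z) = (x ~~> z).
  by rewrite (same_connect (fun a b => F_connect_sym a b) xx').
have [xu|nxu] := boolP (x ~~> u); last by rewrite -!(proj_F tl uv) ?E.
have xv := connect_trans xu (connect1 uv).
by rewrite !(proj_id tl) // E.
Qed.

Lemma proj_const x y z : ~~ (x ~~> y) -> y ~~> z -> r x y = r x z.
Proof.
move=> nxy yz; suff [] : r x y = r x z /\ ~~ (x ~~> z) by [].
apply: (connect_invariant (P := fun u => r x y = r x u /\ ~~ (x ~~> u)) yz) => // u v uv [-> nxu]; split.
  exact: (proj_F tl uv nxu).
by apply: contra nxu => /connect_trans; apply; rewrite F_connect_sym connect1.
Qed.

(** The tree property: [y] lies on the side of [x] as seen from [w], or on the side of [w] as seen
    from [x]. On a walk from [x] to [y] the two projections change only inside the components of [x]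
    and [w]; the former is seen from [w] at [r w x], the latter from [x] at [r x w]. *)
Lemma proj_or x w y : ~~ (x ~~> w) -> r w y = r w x \/ r x y = r x w.
Proof.
move=> nxw; apply: (connect_invariant (P := fun u => r w u = r w x \/ r x u = r x w)
  (TF_connect tl x y)) => [|u v]; first by left.
case/orP=> [uv|uv]; first by rewrite -!(proj_T tl _ uv).
have nwx : ~~ (w ~~> x) by rewrite F_connect_sym.
have [xu _|nxu] := boolP (x ~~> u).
  by left; rewrite -(proj_const nwx (connect_trans xu (connect1 uv))).
have [wu _|nwu] := boolP (w ~~> u).
  by right; rewrite -(proj_const nxw (connect_trans wu (connect1 uv))).
by rewrite -!(proj_F tl uv).
Qed.

Lemma T_proj x z : T x z -> r x z = x.
Proof. by move=> xz; rewrite -(proj_T tl _ xz) proj_self. Qed.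

Lemma T_notconnect x z : T x z -> ~~ (x ~~> z).
Proof.
move=> xz; apply/negP=> /(proj_id tl); rewrite T_proj // => e.
by move: xz; rewrite e (T_irr tl).
Qed.

(** The vertex [y] lies beyond [w], so [w] does not see it at [z], where it sees [x]. By [proj_or],
    [x] then sees [y] where it sees [w], namely through its own T-edge. *)
Lemma beyond_step x z w y : T x z -> F z w -> ~~ (w ~~> y) -> r w y = w ->
  ~~ (x ~~> y) /\ r x y = x.
Proof.
move=> xz zw nwy ewy.
have wz : w ~~> z by rewrite connect1 // (F_sym tl).
have ewx : r w x = z by rewrite (proj_T tl _ xz) (proj_id tl).
have nzw : w != z by apply: contraTneq zw => ->; rewrite (F_irr tl).
have nxz := T_notconnect xz.
have nxw : ~~ (x ~~> w) by apply: contra nxz => /connect_trans; apply.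
have exy : r x y = x.
  case: (proj_or y nxw) => [|->]; first by rewrite ewy ewx => e; rewrite e eqxx in nzw.
  by rewrite -(proj_F tl zw nxz) T_proj.
split=> //; apply/negP=> /(proj_id tl); rewrite exy => e.
by move: nzw; rewrite -ewy -e ewx eqxx.
Qed.

(** A walk that leaves a component by a T-edge never comes back. The induction consumes a T-edge and
    an F-edge at a time, and [beyond_step] carries the conclusion back over them. *)
Lemma alt_walk_beyond x p v : alt_walk T F true x p -> v \in p ->
  ~~ (x ~~> v) /\ r x v = x.
Proof.
have [n] := ubnP (size p); elim: n x p => // n IHn x [|z p] //= sp.
case/andP=> xz; rewrite inE.
have hz : ~~ (x ~~> z) /\ r x z = x by split; [apply: T_notconnect | apply: T_proj].
case: p sp => [_ _|w p sp /= /andP[zw wp]]; first by rewrite orbF => /eqP->.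
have hw : ~~ (x ~~> w) /\ r x w = x.
  case: hz => nxz exz; rewrite -(proj_F tl zw) //; split => //.
  by apply: contra nxz => /connect_trans; apply; rewrite connect1 // (F_sym tl).
rewrite inE => /or3P[/eqP->|/eqP->|vp] //.
have sp' : size p < n by rewrite -ltnS ltnW.
by have [] := IHn w p sp' wp vp; apply: beyond_step xz zw.
Qed.

Lemma alt_walk_uniq x p : alt_walk T F true x p -> uniq (x :: p).
Proof.
have [n] := ubnP (size p); elim: n x p => // n IHn x p sp wp.
have -> /= : uniq (x :: p) = uniq p.
  rewrite /= andbC; case: (uniq p) => //=; apply/negP=> /(alt_walk_beyond wp)[].
  by rewrite connect0.
case: p sp wp => //= z [|w p] //= sp /and3P[xz zw wp].
have /= -> := IHn w p (ltnW sp) wp; rewrite inE negb_or !andbT.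
apply/andP; split; first by apply: contraTneq zw => ->; rewrite (F_irr tl).
apply/negP=> /(alt_walk_beyond wp)[]; by rewrite connect1 // (F_sym tl).
Qed.

(** The projection onto the component of [z] is constant along the walk except on an F-edge inside
    that component, and the walk has at most one such edge. So the two ends project to one vertex or
    to the ends of that edge. *)
Lemma TT_walk_proj x p y : TT_walk T F x p y ->
  [/\ ~~ (x ~~> y), r x y = x, r y x = y &
      forall z, ~~ (z ~~> x) -> ~~ (z ~~> y) -> eq_or_adj (r z x) (r z y)].
Proof.
move=> w; have /and3P[wp op /eqP lp] := w.
have yp : y \in p by rewrite -lp; case: (p) op => //= z q _; apply: mem_last.
have [nxy exy] := alt_walk_beyond wp yp.
have /and3P[wp' op' /eqP lp'] := TT_walk_rev (T_sym tl) (F_sym tl) w.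
have xp : x \in rev (belast x p).
  by rewrite -{1}lp'; case: rev op' => //= z q _; apply: mem_last.
have [_ eyx] := alt_walk_beyond wp' xp.
split=> // {exy eyx xp wp' op' lp' yp wp op lp nxy}.
have [n] := ubnP (size p); elim: n x p w => // n IHn x [|z [|w p]] w0 //= sp q.
  by case/and3P: w0 => /= /andP[xz _] _ /eqP <- _ _; rewrite (proj_T tl _ xz) /eq_or_adj eqxx.
case/and3P: w0 => /= /and3P[xz zw wp]; rewrite negbK => op lp nqx nqy.
have W : TT_walk T F w p y by apply/and3P.
rewrite (proj_T tl _ xz).
have [qz|nqz] := boolP (q ~~> z).
  (* The walk crosses the component of [q] along the edge from [z] to [w]; the rest of it lies
     beyond [w], so [q] sees [y] at [w]. *)
  have qw := connect_trans qz (connect1 zw).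
  have yp : y \in p by rewrite -(eqP lp); case: (p) op => //= t s _; apply: mem_last.
  have [_ ewy] := alt_walk_beyond wp yp.
  by rewrite (proj_id tl qz) (eq_proj y qw) ewy /eq_or_adj zw orbT.
rewrite (proj_F tl zw nqz); apply: (IHn w p) => //; first exact: ltnW.
by apply: contra nqz => /connect_trans; apply; rewrite connect1 // (F_sym tl).
Qed.

(** A T-edge is a bridge. The vertices other than [x] and [z] that satisfy both equations form a set
    closed under edges; since it misses [x], connectedness makes it empty. *)
Lemma T_beyond_both x z y : T x z -> r x y = x -> r z y = z -> y = x \/ y = z.
Proof.
move=> xz ex ez; apply/pred2P; apply: contraT => nyxz.
have: [/\ r x x = x, r z x = z & ~~ pred2 x z x].
  apply: (connect_invariant (P := fun u => [/\ r x u = x, r z u = z & ~~ pred2 x z u])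
    (TF_connect tl y x)) => // u v uv [exu ezu /norP[nux nuz]].
  case/orP: uv => uv.
    rewrite -!(proj_T tl _ uv); split=> //; apply/norP; split.
      apply: contraNneq nuz => vx; rewrite vx (T_sym tl) in uv.
      by rewrite (T_matching tl uv xz).
    apply: contraNneq nux => vz; rewrite vz (T_sym tl) in uv.
    by rewrite (T_matching tl uv (_ : T z x)) // (T_sym tl).
  have nxu : ~~ (x ~~> u) by apply: contra nux => /(proj_id tl) <-; rewrite exu.
  have nzu : ~~ (z ~~> u) by apply: contra nuz => /(proj_id tl) <-; rewrite ezu.
  have vu : v ~~> u by rewrite connect1 // (F_sym tl).
  rewrite -!(proj_F tl uv) //; split=> //; apply/norP; split.
    by apply: contraNneq nxu => <-.
  by apply: contraNneq nzu => <-.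
by case=> _ _; rewrite /= eqxx.
Qed.

Hypothesis T_total : forall x, exists z, T x z.

(** Converse of [TT_walk_proj]. The walk is forced: the T-edge at [x] leads to [z], and the next
    vertex must be the projection [w] of [y] onto the component of [z]. The induction is on the
    number of vertices that see [x] and [y] at different places. *)
Lemma proj_TT_walk x y : ~~ (x ~~> y) -> r x y = x -> r y x = y ->
  (forall z, ~~ (z ~~> x) -> ~~ (z ~~> y) -> eq_or_adj (r z x) (r z y)) ->
  exists p, TT_walk T F x p y.
Proof.
have [n] := ubnP #|[set q | r q x != r q y]|; elim: n x => // n IHn x sn nxy exy eyx H.
have [z xz] := T_total x.
have [->|nzy] := eqVneq y z.
  by exists [:: z]; rewrite /TT_walk /= xz eqxx.
have nconn : ~~ (z ~~> y).
  apply: contra nzy; rewrite F_connect_sym => yz.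
  by rewrite -{1}eyx (proj_T tl _ xz) (proj_id tl).
have nzx : ~~ (z ~~> x) by rewrite F_connect_sym T_notconnect.
have ezx : r z x = z by rewrite (proj_T tl _ xz) proj_self.
(* If [z] saw [y] at [z] itself, then [y] would be seen through both ends of the T-edge [xz]. *)
have := H z nzx nconn; rewrite ezx => /orP[/eqP ezy|].
  case: (T_beyond_both xz exy (esym ezy)) => e; last by rewrite e eqxx in nzy.
  by rewrite e connect0 in nxy.
set w := r z y => zw.
have zwc := connect1 zw.
have nwy : ~~ (w ~~> y) by apply: contra nconn; apply: connect_trans.
have ewy : r w y = w by rewrite -(eq_proj y zwc).
have Ew q : ~~ (q ~~> w) -> r q w = r q x.
  by move=> nqw; rewrite (proj_T tl _ xz) (proj_F tl (_ : F w z)) // (F_sym tl).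
have [|||||p Hp] := IHn w; rewrite ?ewy //.
(* Outside the component of [w], vertices see [w] where they see [x]; inside it, [w] and [y] are
   both seen at [w]. The vertex [w] leaves the set, because it sees [x] at [z]. *)
- rewrite -ltnS; apply: leq_trans sn; rewrite ltnS; apply: proper_card; apply/properP; split.
    apply/subsetP=> q; rewrite !inE; have [qw|nqw] := boolP (q ~~> w); last by rewrite Ew.
    by rewrite (proj_id tl qw) (eq_proj y qw) ewy eqxx.
  exists w; rewrite !inE; last by rewrite proj_self ewy eqxx.
  rewrite -(eq_proj x zwc) ezx ewy.
  by apply: contraTneq zw => <-; rewrite (F_irr tl).
- by rewrite Ew // F_connect_sym.
- move=> q nqw nqy; rewrite Ew //; have [qx|nqx] := boolP (q ~~> x); last exact: H.
  by rewrite (eq_proj y qx) (eq_proj x qx) exy proj_self /eq_or_adj eqxx.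
exists (z :: w :: p); case/and3P: Hp => wp op lp.
by rewrite /TT_walk /= xz zw wp op lp.
Qed.

(** Each further F-edge and T-edge strictly shrinks the set of vertices beyond the current one, so
    the walk gets stuck at a vertex without F-edges. *)
Lemma TT_walk_end x : exists g p, (forall w, ~~ F g w) /\ TT_walk T F x p g.
Proof.
have [n] := ubnP #|[set y | ~~ (x ~~> y) & r x y == x]|; elim: n x => // n IHn x sn.
have [z xz] := T_total x.
have [/existsP[w zw]|/existsPn nF] := boolP [exists w, F z w]; last first.
  by exists z, [:: z]; split=> //; rewrite /TT_walk /= xz eqxx.
have [|g [p [ng Hp]]] := IHn w.
  rewrite -ltnS; apply: leq_trans sn; rewrite ltnS; apply: proper_card; apply/properP; split.
    apply/subsetP=> y; rewrite !inE => /andP[nwy /eqP ewy].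
    by have [-> ->] := beyond_step xz zw nwy ewy; rewrite eqxx.
  exists z; rewrite !inE; first by rewrite T_notconnect // T_proj // eqxx.
  by rewrite connect1 // (F_sym tl).
exists g, (z :: w :: p); split=> //; case/and3P: Hp => wp op lp.
by rewrite /TT_walk /= xz zw wp op lp.
Qed.

End TreeLike.

(** * Split decompositions are trees *)

Lemma tree_like_unmarked (G : graph) : connected G ->
  tree_like (@medge (unmarked G)) (@edge (unmarked G)) (fun _ y => y).
Proof.
move=> Gc; split=> //=; try exact: edge_sym; try exact: edge_irr.
by move=> x y z _; rewrite Gc.
Qed.

Section Decompose.
Variables (D : mgraph) (r : D -> D -> D) (c : D) (A B : {set D}).
Hypotheses (tl : tree_like (@medge D) (@edge D) r)
  (spl : is_split (component c) A B).

Local Notation side b := (if b then A else B).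
Local Notation F' := (@edge (decompose A B)).
Local Notation T' := (@medge (decompose A B)).

Lemma split_component x : (x \in A :|: B) = connect (@edge D) c x.
Proof. by case/and5P: spl => /eqP-> _ _ _ _; rewrite inE. Qed.

Lemma side_sub b x : x \in side b -> x \in A :|: B.
Proof. by rewrite inE; case: b => ->; rewrite ?orbT. Qed.

Lemma side_disjoint b x : x \in side b -> (x \in side (~~ b)) = false.
Proof.
case/and5P: spl => _ dAB _ _ _; case: b => /= h; first exact: disjointFr dAB h.
exact: disjointFl dAB h.
Qed.

Lemma side_exists b : exists x, x \in side b.
Proof.
case/and5P: spl => _ _ A2 B2 _; apply/set0Pn; rewrite -card_gt0.
by case: b; apply: ltnW.
Qed.

Lemma side_or b x : x \in A :|: B -> x \in side b \/ x \in side (~~ b).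
Proof. by rewrite inE => /orP[]; case: b => /=; auto. Qed.

Lemma split_connect x y : x \in A :|: B -> y \in A :|: B -> connect (@edge D) x y.
Proof.
rewrite !split_component (F_connect_sym tl) => cx cy; exact: connect_trans cx cy.
Qed.

Lemma split_edge x y : x \in A :|: B -> edge x y -> y \in A :|: B.
Proof.
by rewrite !split_component => cx xy; apply: connect_trans cx (connect1 xy).
Qed.

Lemma dec_edge_side b x y : x \in side b -> edge x y -> F' (inl x) (inl y) = (y \in side b).
Proof.
move=> xb xy; rewrite /= xy /=.
have nxb := side_disjoint xb; have := split_edge (side_sub xb) xy.
have yd : (y \in A) ==> (y \notin B) by apply/implyP=> /(@side_disjoint true)->.
rewrite inE; case: b xb nxb => /= -> ->; move: yd;
  by case: (y \in A); case: (y \in B).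
Qed.

Lemma dec_edge_marked b x :
  F' (inl x) (inr b) = (x \in side b) && [exists a in side (~~ b), edge a x].
Proof.
have -> : F' (inl x) (inr b) = (x \in nbh (A :|: B) (side (~~ b))) by case: b.
rewrite !inE; case: [exists _ in _, _]; rewrite ?andbF ?andbT //.
by have := @side_disjoint b x; case: b => /=; do 2!case: (x \in _) => //=; move=> ->.
Qed.

Lemma dec_edge_other x y : x \notin A :|: B -> F' (inl x) (inl y) = edge x y.
Proof. by rewrite inE => /norP[/negPf xA /negPf xB] /=; rewrite xA xB andbT. Qed.

(* The component obtained from one side of the split and its marked vertex. *)
Definition dec_block b (u : decompose A B) :=
  match u with inl x => x \in side b | inr b' => b' == b end.

Lemma dec_block_edge b u v : F' u v -> dec_block b u -> dec_block b v.
Proof.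
have H x b' : F' (inl x) (inr b') -> (x \in side b) = (b' == b).
  rewrite dec_edge_marked => /andP[xb' _]; have := side_disjoint xb'; move: xb'.
  by case: b b' => [] [] /= h1 h2; rewrite ?h1 ?h2.
case: u v => [x|b1] [y|b2] //.
- move=> xy xb; have e : edge x y by case/andP: xy.
  by rewrite (dec_edge_side xb e) in xy.
- by move/H => /= ->.
- by rewrite edge_sym => /H /= ->.
Qed.

Lemma dec_connect_sym u v : connect F' u v = connect F' v u.
Proof. exact: (sym_connect_sym (@edge_sym (decompose A B))). Qed.

Lemma dec_connect1 u v : F' u v -> connect F' u v.
Proof. exact: connect1. Qed.

Lemma dec_connect_side b x : x \in side b -> connect F' (inl x) (inr b).
Proof.
move=> xb; have [y yb] := side_exists (~~ b).
have /connectP[p] := split_connect (side_sub xb) (side_sub yb).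
elim: p x xb => [|z p IHp] x xb.
  by move=> _ /= e; rewrite e (side_disjoint xb) in yb.
case/andP=> xz zp /= ly; have xz' := dec_edge_side xb xz.
have [zb|zb] := side_or b (split_edge (side_sub xb) xz).
  by apply: connect_trans (IHp z zb zp ly); rewrite dec_connect1 // xz'.
rewrite dec_connect1 // dec_edge_marked xb; apply/existsP; exists z.
by rewrite zb edge_sym.
Qed.

Lemma dec_block_connect b u : dec_block b u -> connect F' u (inr b).
Proof.
case: u => [x|b'] /=; first exact: dec_connect_side.
by move/eqP->; rewrite connect0.
Qed.

Lemma connect_dec_block b u v : connect F' u v -> dec_block b u = dec_block b v.
Proof.
have H w w' : connect F' w w' -> dec_block b w -> dec_block b w'.
  move=> ww' bw; apply: (connect_invariant (P := dec_block b) ww') => //.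
  by move=> *; apply: dec_block_edge; eauto.
by move=> uv; apply/idP/idP; apply: H; rewrite // dec_connect_sym.
Qed.

Lemma dec_connect_other x u : x \notin A :|: B ->
  connect F' (inl x) u <-> exists2 y, u = inl y & connect (@edge D) x y.
Proof.
move=> xAB.
have out y : connect (@edge D) x y -> y \notin A :|: B.
  move=> xy; apply: contra xAB; rewrite !split_component => cy.
  by apply: connect_trans cy _; rewrite (F_connect_sym tl).
split=> [|[y ->]].
  move=> xu; apply: (connect_invariant (P := fun u => exists2 y, u = inl y & connect (@edge D) x y) xu).
    by exists x.
  move=> w v wv [y ew xy]; have yAB := out y xy; move: wv; rewrite {}ew.
  case: v => [z|b]; last by rewrite dec_edge_marked => /andP[/side_sub]; rewrite (negPf yAB).
  rewrite dec_edge_other // => yz; exists z => //; exact: connect_trans xy (connect1 yz).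
move=> xy; suff [] : connect F' (inl x) (inl y) /\ connect (@edge D) x y by [].
apply: (connect_invariant (P := fun y => connect F' (inl x) (inl y) /\ connect (@edge D) x y) xy).
  by rewrite !connect0.
move=> y1 y2 y12 [c1 c2]; split; last exact: connect_trans c2 (connect1 y12).
by apply: connect_trans c1 (dec_connect1 _); rewrite dec_edge_other // out.
Qed.

(** The old projection onto the split component, with the whole opposite side, and all that is seen
    through it, collapsed to the marked vertex. *)
Definition block_proj b (v : decompose A B) : decompose A B :=
  match v with
  | inl z => if r c z \in side b then inl (r c z) else inr b
  | inr _ => inr b
  end.

(** A component away from the split sees all of the old component at a single vertex, so [c] can
    stand in for both marked vertices there. *)
Definition dec_proj (u v : decompose A B) : decompose A B :=
  match u with
  | inr b => block_proj b v
  | inl x => if x \in A then block_proj true v else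
             if x \in B then block_proj false v else
             inl (r x (if v is inl z then z else c))
  end.

Lemma dec_projE u : (exists2 b, dec_block b u & dec_proj u =1 block_proj b) \/
  exists2 x, u = inl x & x \notin A :|: B /\
    forall v, dec_proj u v = inl (r x (if v is inl z then z else c)).
Proof.
case: u => [x|b]; last by left; exists b => /=.
have [xA|xA] := boolP (x \in A).
  by left; exists true => // v /=; rewrite xA.
have [xB|xB] := boolP (x \in B).
  by left; exists false => // v /=; rewrite xB (negPf xA).
right; exists x => //; rewrite inE negb_or xA xB; split=> // v.
by rewrite /dec_proj (negPf xA) (negPf xB).
Qed.

Lemma tree_like_decompose : tree_like T' F' dec_proj.
Proof.
have proj_in z : z \in A :|: B -> r c z = z.
  by rewrite split_component => /(proj_id tl).
split.
- exact: medge_sym.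
- exact: edge_sym.
- exact: medge_irr.
- exact: edge_irr.
- case=> [x|b1] [y|b2] [z|b3] //=; last by case: b1 b2 b3 => [] [] [].
  by move=> xy xz; rewrite (T_matching tl xy xz).
- set e := fun u v => _.
  have Fe u v : connect F' u v -> connect e u v.
    by apply: connect_sub => {}u {}v uv; rewrite connect1 // /e uv orbT.
  have es : connect_sym e.
    by apply: sym_connect_sym => u v; rewrite /e medge_sym edge_sym.
  have inlc x y : connect e (inl x) (inl y).
    apply: (connect_invariant (P := fun y => connect e (inl x) (inl y)) (TF_connect tl x y)) => //.
    move=> {}y z yz xy; apply: connect_trans xy _.
    case/orP: yz => yz; first by rewrite connect1 // /e /= yz.
    have [yAB|yAB] := boolP (y \in A :|: B); last first.
      by apply/Fe; rewrite dec_connect1 // dec_edge_other.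
    have [b yb] : exists b, y \in side b.
      by move: yAB; rewrite inE => /orP[]; [exists true | exists false].
    have [zb|zb] := side_or b (split_edge yAB yz).
      by apply/Fe; rewrite dec_connect1 // (dec_edge_side yb).
    (* An edge that crosses the split is replaced by a detour through the two marked vertices and
       the marked edge. *)
    apply: connect_trans (Fe _ _ (dec_connect_side yb)) _.
    rewrite es; apply: connect_trans (Fe _ _ (dec_connect_side zb)) _.
    by rewrite connect1 // /e /=; case: (b).
  have H u : connect e u (inl c).
    case: u => // b; have [x xb] := side_exists b.
    by apply: connect_trans (inlc x c); rewrite es; apply/Fe/dec_connect_side.
  by move=> u v; apply: connect_trans (H u) _; rewrite es.
- move=> u v uv; have [[b bu h]|[x eu [xAB h]]] := dec_projE u.
    move: bu; rewrite h (connect_dec_block b uv); case: v {uv} => [z zb|b' /eqP-> //].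
    by rewrite /= proj_in ?(side_sub zb) // [z \in _]zb.
  rewrite h; rewrite eu in uv; have [y -> xy] := (dec_connect_other v xAB).1 uv.
  by rewrite (proj_id tl xy).
- move=> u v w vw; have [[b bu h]|[x eu [xAB h]]] := dec_projE u.
    by rewrite !h; case: v w vw => [y|b1] [z|b2] //= yz; rewrite (proj_T tl _ yz).
  by rewrite !h; case: v w vw => [y|b1] [z|b2] //= yz; rewrite (proj_T tl _ yz).
- move=> u v w vw nuv; have [[b bu h]|[x eu [xAB h]]] := dec_projE u.
    have nbv : ~~ dec_block b v.
      apply: contra nuv => /dec_block_connect bv.
      by apply: connect_trans (dec_block_connect bu) _; rewrite dec_connect_sym.
    have nbw : ~~ dec_block b w.
      by rewrite -(connect_dec_block b (connect1 vw)).
    rewrite !h; case: v w vw nuv nbv nbw => [y|b1] [z|b2] // vw _ nby nbz.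
    + have yz : edge y z by case/andP: vw.
      have [yAB|yAB] := boolP (y \in A :|: B).
        (* Both ends lie on the side opposite to [b], so both are collapsed to [inr b]. *)
        by rewrite /= !proj_in ?(split_edge yAB yz) // [y \in _](negPf nby) [z \in _](negPf nbz).
      by rewrite /= (proj_F tl yz) // -split_component.
    + move: vw; rewrite dec_edge_marked => /andP[/side_sub yAB _].
      by rewrite /= proj_in // [y \in _](negPf nby).
    + move: vw; rewrite edge_sym dec_edge_marked => /andP[/side_sub zAB _].
      by rewrite /= proj_in // [z \in _](negPf nbz).
  have inAB y : y \in A :|: B -> r x y = r x c.
    rewrite split_component => cy; apply/esym/(proj_const tl) => //.
    by rewrite (F_connect_sym tl) -split_component.
  rewrite !h; congr inl; case: v w vw nuv => [y|b1] [z|b2] // vw nuv.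
  + have yz : edge y z by case/andP: vw.
    apply: (proj_F tl yz); apply: contra nuv => xy.
    by rewrite eu; apply/(dec_connect_other _ xAB); exists y.
  + by move: vw; rewrite dec_edge_marked => /andP[/side_sub yAB _]; rewrite inAB.
  + by move: vw; rewrite edge_sym dec_edge_marked => /andP[/side_sub yAB _]; rewrite inAB.
Qed.

End Decompose.

Lemma split_decomposition_tree_like (G : graph) (D : mgraph) :
  connected G -> split_decomposition G D ->
  exists r, tree_like (@medge D) (@edge D) r.
Proof.
move=> Gc; elim=> {D} [|D c A B _ [r tl] spl].
  by exists (fun _ y => y); apply: tree_like_unmarked.
by exists (@dec_proj D r c A B); apply: tree_like_decompose.
Qed.

(** * Distance-hereditary graphs have splits *)

Lemma dist_le2 (G : graph) (x y a : G) : 2 < #|G| -> edge x a -> edge a y ->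
  dist x y <= 2.
Proof.
move=> G3 xa ay; rewrite /dist leqNgt; apply/negP=> /(before_find 0).
rewrite nth_iota // add0n => /existsP[]; exists [tuple a; y].
by rewrite /= xa ay eqxx.
Qed.

(** With more than two vertices, a value at most 2 differs from the default value [#|G|] of [dist],
    so it is the length of an actual walk; lengths 0 and 1 are excluded by the last two
    hypotheses. *)
Lemma dist_le2_inv (G : graph) (x y : G) : 2 < #|G| -> dist x y <= 2 ->
  x != y -> ~~ edge x y -> exists2 a, edge x a & edge a y.
Proof.
move=> G3 d2 nxy nexy.
have lt : dist x y < size (iota 0 #|G|) by rewrite size_iota (leq_ltn_trans d2).
move: (lt); rewrite -has_find => /(nth_find 0).
rewrite -/(dist x y) nth_iota ?add0n; last by rewrite size_iota in lt.
case/existsP=> -[p sp] /= /andP[]; rewrite -(eqP sp) in d2; move: d2.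
case: p {sp} => [|a [|b []]] //= _; first by rewrite (negPf nxy).
  by case/andP=> xa _ /eqP e; rewrite -e xa in nexy.
by case/and3P=> xa ab _ /eqP <-; exists a.
Qed.

Lemma card_gt2 (V : finType) (x y z : V) : x != y -> x != z -> y != z -> 2 < #|V|.
Proof.
move=> xy xz yz; have <- : size [:: x; y; z] = 3 by [].
have u : uniq [:: x; y; z] by rewrite /= !inE negb_or xy xz yz.
by rewrite -(card_uniqP u) max_card.
Qed.

(* The consequence of distance-heredity that is used; unlike distances, it is
   visibly inherited by induced subgraphs. *)
Definition local_dh (G : graph) : Prop := forall (x a b w : G) (p : seq G),
  edge x a -> edge x b -> edge a w -> edge b (last w p) -> path (@edge G) w p ->
  (forall v, v \in w :: p -> (v != x) && ~~ edge x v) -> edge a (last w p).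

(** Let [S] consist of [x], [a] and the walk from [w] to its end [y]. The vertex [b] shows that [y]
    is within distance 2 of [x] in [G], hence in [G[S]], where a walk of length 2 from [x] to [y]
    has to pass through [a]. *)
Lemma distance_hereditary_local (G : graph) : distance_hereditary G -> local_dh G.
Proof.
move=> dh x a b w p xa xb aw by_ wp far; set y := last w p.
have xNw : x != w by have /andP[] := far w (mem_head _ _); rewrite eq_sym.
have xNa : x != a by apply: contraTneq xa => ->; rewrite edge_irr.
have aNw : a != w by apply: contraTneq aw => ->; rewrite edge_irr.
(* In G[S] the vertex a is the only neighbour of x. *)
pose S : {set G} := [set v in [:: x, a, w & p]].
have xS : x \in S by rewrite !inE eqxx.
have aS : a \in S by rewrite !inE eqxx orbT.
have inS v : v \in w :: p -> v \in S by rewrite !inE => ->; rewrite !orbT.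
pose I := induced S; pose x' : I := Sub x xS; pose a' : I := Sub a aS.
pose w' : I := Sub w (inS w (mem_head _ _)).
pose y' : I := Sub y (inS y (mem_last _ _)).
have sym := sym_connect_sym (@edge_sym I).
have conn : connected I.
  have wI v (vp : v \in w :: p) : connect (@edge I) w' (Sub v (inS v vp)).
    have := vp; rewrite inE => vp'.
    have: exists2 q, path (@edge G) w q & last w q = v /\ {subset q <= p}.
      case/orP: vp' => [/eqP->|vp']; first by exists [::].
      case/splitPr: vp' wp => p1 p2; rewrite cat_path /= => /and3P[wp1 lv _].
      exists (rcons p1 v); first by rewrite rcons_path wp1.
      split=> [|t]; first by rewrite last_rcons.
      by rewrite mem_rcons mem_cat !inE => /orP[->|->]; rewrite ?orbT.
    case=> q {vp'}; elim/last_ind: q v vp => [|q t IHq] v vp.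
      by move=> _ [/= e _]; rewrite (_ : Sub _ _ = w') ?connect0 //; apply: val_inj.
    rewrite rcons_path => /andP[wq qt] [lt sub]; rewrite last_rcons in lt; subst t.
    have sub' : {subset q <= p} by move=> t tq; apply: sub; rewrite mem_rcons inE tq orbT.
    have lq : last w q \in w :: p.
      by have := mem_last w q; rewrite !inE => /predU1P[->|/sub'->]; rewrite ?eqxx ?orbT.
    apply: connect_trans (IHq _ lq wq (conj erefl sub')) _.
    exact: (@connect1 _ (@edge I)).
  have H (u : I) : connect (@edge I) a' u.
    have aw' : connect (@edge I) a' w' by apply: (@connect1 _ (@edge I)).
    case: u => u uS; have := uS; rewrite !inE => /or3P[/eqP e|/eqP e|up].
    - rewrite sym (_ : exist _ u uS = x'); last exact: val_inj.
      exact: (@connect1 _ (@edge I)).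
    - by rewrite (_ : exist _ u uS = a') ?connect0 //; apply: val_inj.
    - apply: connect_trans aw' _.
      by rewrite (_ : exist _ u uS = Sub u (inS u up)) ?wI //; apply: val_inj.
  by move=> u v; apply: connect_trans (H v); rewrite sym.
have /andP[yNx nxy] := far y (mem_last _ _).
have I3 : 2 < #|I| by apply: (@card_gt2 _ x' a' w').
have d2 : dist x' y' <= 2.
  by rewrite dh //= (@dist_le2 _ _ _ b) //; apply: (@card_gt2 _ x a w).
have xNy' : x' != y' by rewrite -(inj_eq val_inj) /= eq_sym.
have [s xs sy] := dist_le2_inv I3 d2 xNy' nxy.
have : val s \in S by apply: valP.
rewrite !inE => /or3P[/eqP e|/eqP e|/far/andP[_]].
- by move: xs; rewrite /= /induced_edge e edge_irr.
- by move: sy; rewrite /= /induced_edge e.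
- by rewrite [edge _ _]xs.
Qed.

Lemma setU_setD (V : finType) (X Y : {set V}) : X \subset Y -> X :|: (Y :\: X) = Y.
Proof. by move=> /setIidPr {1}<-; apply: setID. Qed.

Lemma disjoint_setD (V : finType) (X Y : {set V}) : [disjoint X & Y :\: X].
Proof. by rewrite disjoints_subset setCD subsetUr. Qed.

(** * Clique, star or split: around a vertex of minimum degree *)

Section MinimumDegree.
Variables (G : graph) (c : G).
Local Notation C := (component c).
Hypotheses (C3 : 3 <= #|C|) (dh : local_dh G).

Local Notation N x := [set y | edge x y].

Lemma component_edge x y : x \in C -> edge x y -> y \in C.
Proof. by rewrite !inE => cx xy; apply: connect_trans cx (connect1 xy). Qed.

Lemma component_connect x y : x \in C -> y \in C -> connect (@edge G) x y.
Proof.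
rewrite !inE (sym_connect_sym (@edge_sym G)); exact: connect_trans.
Qed.

Lemma component_neighbour x : x \in C -> exists y, edge x y.
Proof.
move=> xC; have /card_gt0P[y] : 0 < #|C :\ x|.
  by move: C3; rewrite (cardsD1 x) xC; case: #|_|.
rewrite 2!inE => /andP[yx /(component_connect xC)/connectP[[|z p]]] /=.
  by move=> _ e; rewrite e eqxx in yx.
by case/andP=> xz _ _; exists z.
Qed.

Lemma clique_star_or_split :
  [\/ is_clique C, is_star C | exists A B, is_split C A B].
Proof.
have [x xC minx] : exists2 x, x \in C & forall y, y \in C -> #|N x| <= #|N y|.
  have cC : c \in C by rewrite inE connect0.
  by case: (@arg_minnP _ c (mem C) (fun x => #|N x|) cC) => x xC m; exists x.
have NC y : y \in C -> N y \subset C :\ y.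
  move=> yC; apply/subsetP=> z; rewrite inE => yz; rewrite in_setD1 (component_edge yC yz) andbT.
  by apply: contraTneq yz => ->; rewrite edge_irr.
have [/existsP[w /and3P[wC wx nxw]]|/existsPn univ] :=
  boolP [exists w, [&& w \in C, w != x & ~~ edge x w]]; last first.
  (* Here [x] is adjacent to all other vertices of [C], so by minimality every vertex of [C] has
     degree [#|C| - 1]. *)
  constructor 1; apply/forall_inP=> y yC; apply/forall_inP=> z zC; apply/implyP=> yz.
  have Nx : N x = C :\ x.
    apply/eqP; rewrite eqEsubset NC //=; apply/subsetP=> t; rewrite in_setD1 => /andP[tx tC].
    by have := univ t; rewrite tC tx negbK inE.
  have Ny : N y = C :\ y.
    apply/eqP; rewrite eqEcard NC //= (leq_trans _ (minx y yC)) // Nx.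
    by have := cardsD1 y C; rewrite (cardsD1 x C) xC yC => /addnI->.
  have : z \in C :\ y by rewrite in_setD1 eq_sym yz.
  by rewrite -Ny inE.
pose far y := (y != x) && ~~ edge x y.
pose e := [rel u v | [&& edge u v, far u & far v]].
have esym : symmetric e by move=> u v /=; rewrite edge_sym [far u && _]andbC.
have ecs := sym_connect_sym esym.
pose R := [set v | connect e w v].
have farw : far w by rewrite /far wx.
have Rfar v : v \in R -> far v /\ v \in C.
  rewrite inE => /connectP[p]; elim: p w {R wx nxw} wC farw => [|z p IHp] u uC fu /=.
    by move=> _ ->.
  case/andP=> /and3P[uz _ fz] zp; apply: IHp => //; exact: component_edge uz.
have Rnb v z : v \in R -> edge v z -> z \notin R -> edge x z.
  move=> vR vz; apply: contraNT => nxz; have [fv _] := Rfar v vR.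
  rewrite inE in vR; rewrite inE; apply: connect_trans vR (connect1 _).
  rewrite /= vz fv /far nxz andbT; case/andP: fv => _; apply: contraNneq => <-.
  by rewrite edge_sym.
have wR : w \in R by rewrite inE connect0.
have RC : R \subset C by apply/subsetP=> v /Rfar[].
have [a0 xa0] := component_neighbour xC.
have xNR : x \notin R by apply/negP=> /Rfar[]; rewrite /far eqxx.
have a0NR : a0 \notin R by apply/negP=> /Rfar[]; rewrite /far xa0 andbF.
have [R2|R1] := ltnP 1 #|R|.
  constructor 3; exists R, (C :\: R); apply/and5P; split=> //.
  - by rewrite setU_setD.
  - exact: disjoint_setD.
  (* The complement of [R] contains [x] and its neighbour [a0]. *)
  - have <- : #|[set x; a0]| = 2.
      by rewrite cards2; case: eqP => // e0; rewrite e0 edge_irr in xa0.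
    apply/subset_leq_card/subsetP=> v /set2P[]->; apply/setDP; split=> //.
    exact: component_edge xa0.
  (* The vertices [a] and [b] outside [R], attached to [r] and [r'] in [R], are neighbours of [x] by
     [Rnb]. A path from [r] to [r'] inside [R] avoids [x] and its neighbours, so [dh] makes [a]
     adjacent to [r']. *)
  apply/forall_inP=> a; rewrite inE => /andP[aCR /exists_inP[r rR ra]].
  apply/forall_inP=> r'; rewrite inE => /andP[/setDP[r'C r'D] /exists_inP[b /setDP[bC bR] br']].
  have r'R : r' \in R by apply: contraNT r'D => h; apply/setDP.
  have {}aCR : a \notin R by case/setDP: aCR.
  have /connectP[p rp er'] : connect e r r'.
    by move: rR r'R; rewrite !inE ecs; apply: connect_trans.
  have sub : subrel e (@edge G) by move=> ? ? /and3P[].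
  have xa := Rnb r a rR ra aCR; have xb := Rnb r' b r'R _ bR.
  rewrite er'; apply: (dh (x := x) (b := b)).
  - exact: xa.
  - by apply: xb; rewrite edge_sym.
  - by rewrite edge_sym.
  - by rewrite -er'.
  - exact: sub_path rp.
  - have fr : far r by case: (Rfar r rR).
    elim: p r {rR ra er'} rp fr => [|z p IHp] r /=; first by move=> _ fr v; rewrite inE => /eqP->.
    by case/andP=> /and3P[_ _ fz] zp fr v; rewrite inE => /predU1P[->//|]; apply: IHp.
have eR : R = [set w] by apply/eqP; rewrite eq_sym eqEcard sub1set wR cards1.
have Nwx : N w = N x.
  apply/eqP; rewrite eqEcard minx // andbT; apply/subsetP=> z; rewrite !inE => wz.
  apply: (Rnb w) => //; rewrite eR inE; apply: contraTneq wz => ->.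
  by rewrite edge_irr.
have xwC : [set x; w] \subset C by apply/subsetP=> v /set2P[]->.
have cxw : #|[set x; w]| = 2 by rewrite cards2 eq_sym wx.
have Nw v : edge w v = edge x v by move/setP/(_ v): Nwx; rewrite !inE.
(* Now [x] and [w] are non-adjacent twins: they can be split off if two other vertices remain;
   otherwise [C] is the star on [x], [w] and [a0] with center [a0]. *)
have [R2|R2] := ltnP 1 #|C :\: [set x; w]|.
  constructor 3; exists [set x; w], (C :\: [set x; w]); apply/and5P; split=> //.
  - by rewrite setU_setD.
  - exact: disjoint_setD.
  - by rewrite cxw.
  apply/forall_inP=> a; rewrite inE => /andP[_ /exists_inP[r]].
  rewrite !inE => rxw ra.
  apply/forall_inP=> b; rewrite inE => /andP[/setDP[bC bD] _].
  have : b \in [set x; w] by apply: contraNT bD => h; apply/setDP.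
  rewrite edge_sym !inE => bxw; have xa : edge x a by case/orP: rxw ra => /eqP->; rewrite ?Nw.
  by case/orP: bxw => /eqP->; rewrite ?Nw.
constructor 2; apply/existsP; exists a0.
have xNa : x != a0 by apply: contraTneq xa0 => ->; rewrite edge_irr.
have wNa : w != a0 by apply: contraNneq nxw => ->.
have c3 : #|[set x; w; a0]| = 3.
  by rewrite setUC cardsU1 cxw !inE ![a0 == _]eq_sym (negPf xNa) (negPf wNa).
have eC : C = [set x; w; a0].
  apply/eqP; rewrite eq_sym eqEcard subUset xwC sub1set (component_edge xC xa0) /=.
  by rewrite c3 -(cardsID [set x; w] C) (setIidPr xwC) cxw (leq_add2l 2 _ 1).
rewrite /star_center eC !inE eqxx orbT /=.
have wa0 : edge w a0 by rewrite Nw.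
have wx' : edge w x = false by rewrite Nw edge_irr.
apply/forall_inP=> u; rewrite !inE => hu; apply/forall_inP=> v; rewrite !inE => hv.
by case/orP: hu => [/orP[]|] /eqP->; case/orP: hv => [/orP[]|] /eqP->;
  rewrite ?edge_irr ?(edge_sym a0) ?xa0 ?wa0 ?wx' ?(edge_sym x w) ?wx' ?eqxx
    ?(negPf xNa) ?(negPf wNa).
Qed.
End MinimumDegree.

(** * Induced P4s and s-leaf-paths *)

(** Distinctness of the four vertices follows from the six conditions. *)
Definition is_P4 (G : graph) (a b c d : G) : bool :=
  [&& edge a b, edge b c, edge c d, ~~ edge a c, ~~ edge b d & ~~ edge a d].

Lemma has_induced_P4 (G : graph) :
  has_induced G (path_graph 4) <-> exists a b c d : G, is_P4 a b c d.
Proof.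
split=> [[S [f [g fK gK] fe]]|[a [b [c [d /and5P[ab bc cd ac /andP[bd ad]]]]]]].
  have ge i j : edge (val (g i)) (val (g j)) = @edge (path_graph 4) i j.
    by have := fe (g i) (g j); rewrite !gK => ->.
  pose v (i : nat) (lt : i < 4) := val (g (Ordinal lt)).
  exists (@v 0 isT), (@v 1 isT), (@v 2 isT), (@v 3 isT).
  by rewrite /is_P4 /v !ge.
pose s := [:: a; b; c; d].
have us : uniq s.
  have ne (u v t : G) : edge u t -> ~~ edge v t -> u != v.
    by move=> ut nvt; apply: contraNneq nvt => <-.
  rewrite /= !inE !negb_or (ne a b b) ?edge_irr // (ne b c c) ?edge_irr //.
  rewrite (ne c d d) ?edge_irr // (ne b d a) 1?edge_sym //= 1?edge_sym // andbT.
  by rewrite ![a == _]eq_sym (ne c a d) // (ne d a c) // edge_sym.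
pose S : {set G} := [set x in s]; pose f (x : induced S) : 'I_4 := inord (index (val x) s).
have inds (x : induced S) : exists2 i, i < 4 & val x = nth a s i.
  have xs : val x \in s by have := valP x; rewrite inE.
  by exists (index (val x) s); rewrite ?nth_index // -[4]/(size s) index_mem.
have fE (x : induced S) i : i < 4 -> val x = nth a s i -> f x = i :> nat.
  by move=> i4 e; rewrite /f e index_uniq // inordK.
exists S; exists f.
  have nS (i : 'I_4) : nth a s i \in S by rewrite inE mem_nth.
  exists (fun i : 'I_4 => Sub (nth a s i) (nS i)).
    by move=> x; have [i i4 e] := inds x; apply: val_inj; rewrite /= (fE x i i4 e) e.
  by move=> i; apply: ord_inj; rewrite (fE _ i).
move=> x y; have [i i4 ex] := inds x; have [j j4 ey] := inds y.
rewrite /= /path_edge /induced_edge (fE x i) // (fE y j) // ex ey.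
by case: i i4 {ex} => [|[|[|[|]]]] // _; case: j j4 {ey} => [|[|[|[|]]]] //= _;
  rewrite ?edge_irr ?ab ?bc ?cd ?(negPf ac) ?(negPf bd) ?(negPf ad) //
    edge_sym ?ab ?bc ?cd ?(negPf ac) ?(negPf bd) ?(negPf ad).
Qed.

Lemma graph_iso_P4 (G H : graph) : graph_iso H G ->
  (exists a b c d : H, is_P4 a b c d) <-> (exists a b c d : G, is_P4 a b c d).
Proof.
case=> f [g fK gK] fe; split=> -[a [b [c [d abcd]]]].
  by exists (f a), (f b), (f c), (f d); rewrite /is_P4 !fe.
by exists (g a), (g b), (g c), (g d); rewrite /is_P4 -!fe !gK.
Qed.

Lemma graph_iso_local_dh (G H : graph) : graph_iso H G -> local_dh G -> local_dh H.
Proof.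
case=> f [g fK gK] fe dh x a b w p xa xb aw bl wp far.
rewrite -fe -last_map; apply: (dh (f x) _ (f b)); rewrite ?fe //.
- by rewrite last_map fe.
- by rewrite path_map (eq_path (e' := @edge H)).
move=> v; rewrite -map_cons => /mapP[u /far/andP[ux xu] ->].
by rewrite (can_eq fK) ux fe.
Qed.

Lemma eq_component (G : graph) (x y : G) : connect (@edge G) x y -> component x = component y.
Proof.
move=> xy; apply/setP=> z; rewrite !inE.
exact: same_connect (sym_connect_sym (@edge_sym G)) _ _ xy z.
Qed.

Lemma mem_zip_last (I : eqType) (u t : I) q :
  (last u q, t) \in zip (u :: rcons q t) (rcons q t).
Proof.
elim: q u => [|w q IHq] u /=; first by rewrite mem_head.
by rewrite inE IHq orbT.
Qed.

Lemma mem_zip_belast (I : eqType) (x u v : I) p :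
  (u, v) \in zip (x :: p) p -> u \in belast x p /\ v \in p.
Proof.
elim: p x => //= y p IHp x; rewrite !inE.
by case/orP=> [/eqP[-> ->]|/IHp[-> ->]]; rewrite ?eqxx ?orbT.
Qed.

Lemma star_edge (G : graph) (C : {set G}) k u v : star_center C k ->
  u \in C -> v \in C -> edge u v = ((u == k) != (v == k)).
Proof. by case/andP=> _ /forall_inP st uC vC; apply/eqP/(forall_inP (st u uC)). Qed.

Lemma star_center_adj (G : graph) (C : {set G}) k u : star_center C k ->
  u \in C -> eq_or_adj (@edge G) k u.
Proof.
move=> st uC; have /andP[kC _] := st.
by rewrite /eq_or_adj (star_edge st) // eqxx eq_sym; case: eqP.
Qed.

(** Two distinct non-adjacent vertices of a star are leaves, and only the center is equal or
    adjacent to both. *)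
Lemma star_middle (G : graph) (C : {set G}) k u t v : star_center C k ->
  u \in C -> t \in C -> v \in C ->
  eq_or_adj (@edge G) u t -> eq_or_adj (@edge G) t v -> ~~ eq_or_adj (@edge G) u v ->
  [/\ t = k, u != k & v != k].
Proof.
move=> st uC tC vC; rewrite /eq_or_adj !(star_edge st) // negb_or negbK.
move=> ut tv /andP[nuv /eqP uv].
have nuk : u != k.
  by apply: contraNneq nuv => e; move: uv; rewrite e eqxx => /esym/eqP->.
have nvk : v != k by rewrite -uv.
split=> //; apply/eqP; apply: contraT => ntk; move: ut tv.
rewrite (negPf nuk) (negPf nvk) (negPf ntk) !orbF => /eqP ut /eqP tv.
by rewrite ut tv eqxx in nuv.
Qed.

(** * The graph-labelled tree as a tree of components *)

Section GraphLabelledTree.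
Variables (D : mgraph) (r : D -> D -> D).
Hypothesis tl : tree_like (@medge D) (@edge D) r.

Local Notation T := (@tf_tedge D).
Local Notation F := (@tf_fedge D).

Definition tf_anchor (v : tf_vert D) : D :=
  match v with inl y => y | inr a => val a end.

(* Pendant vertices are components of their own. *)
Definition tf_proj (u v : tf_vert D) : tf_vert D :=
  if u is inl x then inl (r x (tf_anchor v)) else u.

Lemma tf_connect u v : connect F u v ->
  match u with
  | inl x => exists2 y, v = inl y & connect (@edge D) x y
  | inr _ => v = u
  end.
Proof.
move=> uv; apply: (connect_invariant (P := fun v => match u with
  | inl x => exists2 y, v = inl y & connect (@edge D) x y
  | inr _ => v = u end) uv) => [|w v' wv].
  by case: u {uv} => // x; exists x.
case: u {uv} => [x [y ew xy]|a ew]; rewrite ew in wv => //.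
case: v' wv => // z yz; exists z => //; apply: connect_trans xy _; exact: (@connect1 _ (@edge D)).
Qed.

Lemma tf_connect_inl x y : connect F (inl x) (inl y) = connect (@edge D) x y.
Proof.
apply/idP/idP => [/tf_connect[z [->]] //|xy].
apply: (connect_invariant (P := fun y => connect F (inl x) (inl y)) xy) => // u v uv xu.
by apply: connect_trans xu _; apply: (@connect1 _ F (inl u) (inl v)).
Qed.

(** Pendant edges are attached exactly to the vertices without a marked edge, so the T-edges still
    form a matching, which by [tf_tedge_total] now covers every vertex. *)
Lemma tf_tree_like : tree_like T F tf_proj.
Proof.
have unm (a : pendant D) y : medge (val a) y -> False.
  by move=> ay; case/negP: (valP a); apply/existsP; exists y.
split.
- exact: tf_tedge_sym.
- exact: tf_fedge_sym.
- by case=> [x|a] //=; apply: medge_irr.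
- by case=> [x|a] //=; apply: edge_irr.
- case=> [x|a] [y|b] [z|b'] //=.
  + by move=> xy xz; rewrite (T_matching tl xy xz).
  + by move=> xy /eqP e; rewrite e in xy; case: (unm _ _ xy).
  + by move=> /eqP e xz; rewrite e in xz; case: (unm _ _ xz).
  + by move=> /eqP -> /eqP/val_inj ->.
  + by move=> /eqP -> /eqP ->.
- set e := fun u v => _.
  have es : connect_sym e.
    by apply: sym_connect_sym => u v; rewrite /e tf_tedge_sym tf_fedge_sym.
  have H u : connect e u (inl (tf_anchor u)).
    by case: u => // a; apply: connect1; rewrite /e /= eqxx.
  have I x y : connect e (inl x) (inl y).
    apply: (connect_invariant (P := fun y => connect e (inl x) (inl y)) (TF_connect tl x y)) => //.
    by move=> u v uv xu; apply: connect_trans xu (@connect1 _ e _ _ _).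
  move=> u v; apply: connect_trans (H u) _; apply: connect_trans (I _ _) _.
  by rewrite es.
- move=> u v /tf_connect; case: u => [x [y -> xy]|a ->] //=.
  by rewrite (proj_id tl).
- case=> [x|a] // [y|b] [z|b'] //= yz; first by rewrite (proj_T tl _ yz).
    by rewrite (eqP yz).
  by rewrite (eqP yz).
- case=> [x|a] // [y|b] [z|b'] // yz; rewrite tf_connect_inl => nxy.
  by rewrite /= (proj_F tl yz).
Qed.

Lemma tf_tedge_total (u : tf_vert D) : exists v, T u v.
Proof.
case: u => [x|a]; last by exists (inl (val a)) => /=.
have [/existsP[y xy]|nm] := boolP (marked x); first by exists (inl y).
by exists (inr (Sub x nm)) => /=.
Qed.

Lemma alternatingE b u p : @alternating D b u p = alt_walk T F b u p.
Proof. by elim: p b u => //= v p IHp b u; rewrite IHp. Qed.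

Lemma eq_or_adj_inl x y : eq_or_adj F (inl x) (inl y) = eq_or_adj (@edge D) x y.
Proof. by []. Qed.

Lemma TT_walk_alternated u p v : TT_walk T F u p v -> alternated_path u p.
Proof.
case/and3P=> wp _ _; rewrite /alternated_path (alt_walk_uniq tf_tree_like) //.
by rewrite alternatingE wp.
Qed.

(** Pendant vertices have no F-edge, which forces T-edges at both ends of the path. Conversely, a
    [TT_walk] repeats no vertex, so it is a path and obeys the length bound of [accessible]. *)
Lemma accessible_TT_walk (a b : pendant D) :
  accessible a b <-> a != b /\ exists p, TT_walk T F (inr a) p (inr b).
Proof.
have Fb u : F u (inr b) = false by case: u.
split=> [/andP[ab /existsP[n /existsP[p /andP[/andP[_ alt] lp]]]]|[ab [p w]]].
  split=> //; exists p; rewrite /TT_walk lp andbT; case: (tval p) lp alt => /= [|v q] lp.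
    by move: ab; rewrite -(inj_eq (@inr_inj D _)) [_ == _]lp.
  rewrite orbF; case/andP => av; rewrite alternatingE av /= => wq.
  rewrite wq /=; move: wq; case/lastP: q lp => // q t; rewrite last_rcons => /eqP->.
  by rewrite -cats1 alt_walk_cat size_cat /= addn1 /= negbK; case: odd => //; rewrite Fb !andbF.
have lt : size p < #|{: tf_vert D}|.
  have /andP[up _] := TT_walk_alternated w.
  by have := max_card (mem (inr a :: p)); rewrite (card_uniqP up).
rewrite /accessible ab; apply/existsP; exists (Ordinal lt); apply/existsP.
exists (in_tuple p); rewrite (TT_walk_alternated w); by case/and3P: w.
Qed.

Lemma accessible_eq_or_adj (a b : pendant D) x : accessible a b ->
  eq_or_adj (@edge D) (r x (val a)) (r x (val b)).
Proof.
move=> /accessible_TT_walk[_ [p /(TT_walk_proj tf_tree_like)[_ _ _ H]]].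
by rewrite -eq_or_adj_inl; apply: (H (inl x)); apply/negP=> /tf_connect[].
Qed.

Lemma not_accessible_proj (a b : pendant D) : a != b -> ~~ accessible a b ->
  exists x, ~~ eq_or_adj (@edge D) (r x (val a)) (r x (val b)).
Proof.
move=> ab nab; apply/existsP; apply: contraR nab => /existsPn H.
apply/accessible_TT_walk; split=> //.
apply: (proj_TT_walk tf_tree_like tf_tedge_total) => //.
  by apply/negP=> /tf_connect[e]; rewrite e eqxx in ab.
case=> [x|c] _ _; last by rewrite /eq_or_adj eqxx.
by have := H x; rewrite negbK.
Qed.

(** An F-edge at either end of the path would be an edge of the star of [x] or of [y]. *)
Lemma s_leaf_path_TT_walk x y p : s_leaf_path x y p -> TT_walk T F (inl x) p (inl y).
Proof.
case=> -[/andP[_ alt] lp] _ _ nxy ne.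
have {}ne u v : (u, v) \in zip (inl x :: p) p -> F u v ->
    ~~ connect F (inl x) v /\ ~~ connect F (inl y) u.
  move=> uv Fuv; have [] := ne _ uv; case: u v uv Fuv => [u|//] [v|//] _ /= uv.
  rewrite !tf_connect_inl uv !andbT !inE => nx ny; split.
    apply: contra nx => xv; rewrite xv andbT; apply: connect_trans xv _.
    by rewrite connect1 // edge_sym.
  apply: contra ny => yu; rewrite yu; exact: connect_trans yu (connect1 uv).
case: p lp alt ne => [|v p] lp alt ne.
  by move: lp nxy => /= [->]; rewrite eqxx.
have Hx : T (inl x) v.
  case/orP: alt => /andP[xv _] //; have [] := ne _ _ (mem_head _ _) xv.
  by rewrite connect1.
have alt' : alt_walk T F true (inl x) (v :: p).
  case/orP: alt; rewrite alternatingE // => /andP[xv _].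
  by have [] := ne _ _ (mem_head _ _) xv; rewrite connect1.
rewrite /TT_walk alt' lp eqxx andbT.
case/lastP: {Hx alt}(v :: p) lp alt' ne => [|q t].
  by move=> /= [e]; move: nxy; rewrite e eqxx.
rewrite last_rcons => -> ; rewrite -cats1 alt_walk_cat size_cat addn1 /=.
case: (boolP (odd _)) => //= _ /and3P[_ Fy _] ne.
have [] := ne (last (inl x) q) (inl y) _ Fy.
  by rewrite cats1; apply: mem_zip_last.
by move=> _; rewrite connect1 // tf_fedge_sym.
Qed.

(** * Pendant representatives of the vertices of the split components *)

Hypothesis C3 : forall x : D, 3 <= #|component x|.

(** [TT_walk_end] stops at a vertex without F-edges; this must be a pendant vertex, because
    components with three vertices leave no vertex isolated. *)
Lemma exists_representative : exists g : D -> pendant D,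
  forall x, exists p, TT_walk T F (inl x) p (inr (g x)).
Proof.
apply: (fin_all_exists (U := fun _ => pendant D)
  (P := fun x a => exists p, TT_walk T F (inl x) p (inr a))) => x.
have [[y|a] [p [nF w]]] := TT_walk_end tf_tree_like tf_tedge_total (inl x); last by exists a, p.
have yC : y \in component y by rewrite inE connect0.
have [z yz] := component_neighbour (C3 y) yC.
by have /negP[] := nF (inl z).
Qed.

Section Representative.
Variable g : D -> pendant D.
Hypothesis gP : forall x, exists p, TT_walk T F (inl x) p (inr (g x)).

Lemma representative_proj x y : connect (@edge D) x y -> r x (val (g y)) = y.
Proof.
move=> xy; rewrite (eq_proj tl _ xy); have [p w] := gP y.
by have [_ [->]] := TT_walk_proj tf_tree_like w.
Qed.

Lemma representative_inj x y : connect (@edge D) x y -> x != y -> g x != g y.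
Proof.
move=> xy; apply: contraNneq => e.
by rewrite -{1}(@representative_proj x x) ?connect0 // e representative_proj.
Qed.

(** From [y], the vertex [g t] is seen at [t] but [x] is seen at [y]; by [proj_or], [x] then sees
    [g t] where it sees [y]. *)
Lemma representative_far x y p t : TT_walk T F (inl x) p (inl y) ->
  connect (@edge D) y t -> t != y -> r x (val (g t)) = x.
Proof.
move=> w yt nty; have [nxy [exy] [eyx] _] := TT_walk_proj tf_tree_like w.
rewrite tf_connect_inl in nxy.
have [|->//] := proj_or tl (val (g t)) nxy.
by rewrite representative_proj // eyx => e; rewrite e eqxx in nty.
Qed.

Lemma representative_walk x y p u v : TT_walk T F (inl x) p (inl y) ->
  edge u x -> edge y v -> accessible (g u) (g v).
Proof.
move=> w ux yv; have [p1 /(TT_walk_rev (@tf_tedge_sym D) (@tf_fedge_sym D)) w1] := gP u.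
have [p2 w2] := gP v.
apply/accessible_TT_walk; split.
  have xu : connect (@edge D) x u by rewrite connect1 // edge_sym.
  apply: contraTneq ux => e; rewrite -(representative_proj xu) e.
  rewrite (representative_far w) ?edge_irr ?connect1 //.
  by apply: contraTneq yv => ->; rewrite edge_irr.
have w' : TT_walk T F (inr (g u)) (rev (belast (inl u) p1) ++ inl x :: p) (inl y).
  exact: TT_walk_cat w1 _ w.
by eexists; apply: TT_walk_cat w' _ w2.
Qed.

(** Thus [g] embeds every split component into the accessibility graph as an induced subgraph, which
    is how [local_dh] passes to the components. *)
Lemma accessible_representative x y : connect (@edge D) x y ->
  accessible (g x) (g y) = edge x y.
Proof.
move=> xy; have [exy|nxy] := eqVneq x y; first by rewrite exy edge_irr accessible_irr.
have ng := representative_inj xy nxy.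
apply/idP/idP => [/(accessible_eq_or_adj x)|exy].
  by rewrite /eq_or_adj !representative_proj ?connect0 // (negPf nxy).
apply/accessible_TT_walk; split=> //.
have [p1 /(TT_walk_rev (@tf_tedge_sym D) (@tf_fedge_sym D)) w1] := gP x.
have [p2 w2] := gP y; eexists; exact: TT_walk_cat w1 _ w2.
Qed.
End Representative.

Lemma local_dh_mgraph : local_dh (accessibility_graph D) -> local_dh D.
Proof.
have [g gP] := exists_representative.
move=> dh x a b w p xa xb aw bl wp far; set y := last w p.
have xw : connect (@edge D) x w.
  exact: connect_trans (connect1 xa) (connect1 aw).
have xq q : q \in w :: p -> connect (@edge D) x q.
  by move=> qp; apply: connect_trans xw (path_connect wp qp).
have gE u v : edge u v -> accessible (g u) (g v).
  by move=> uv; rewrite accessible_representative ?connect1.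
have ay : connect (@edge D) a y.
  apply: connect_trans (xq _ (mem_last _ _)); rewrite connect1 // edge_sym //.
rewrite -(accessible_representative gP ay) -last_map.
apply: (dh (g x) _ (g b)); rewrite ?last_map; try exact: gE.
  by rewrite path_map; apply: sub_path wp => u v; apply: gE.
move=> t; rewrite -map_cons => /mapP[u up ->]; have /andP[ux nxu] := far u up.
rewrite [edge _ _]accessible_representative ?xq // nxu andbT.
by rewrite eq_sym (representative_inj gP (xq u up)) // eq_sym.
Qed.

(** * From an induced P4 to an s-leaf-path *)

Section Types.
Hypothesis dh : local_dh (accessibility_graph D).
Hypothesis types : forall x : D, [|| is_clique (component x),
    is_star (component x) | is_prime (component x)].

Lemma component_star x u v : connect (@edge D) x u -> connect (@edge D) x v ->
  ~~ eq_or_adj (@edge D) u v -> exists k, star_center (component x) k.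
Proof.
move=> xu xv /norP[nuv euv].
have ncl : ~~ is_clique (component x).
  apply/negP=> /forall_inP cl; have uC : u \in component x by rewrite inE.
  have /forall_inP/(_ v) := cl u uC; rewrite inE => /(_ xv).
  by rewrite nuv (negPf euv).
apply/existsP; case: (clique_star_or_split (C3 x) (local_dh_mgraph dh)) => //.
  by move=> cl; rewrite cl in ncl.
case=> A [B spl]; have := types x; rewrite (negPf ncl) /= => /orP[//|].
by move=> /forallP/(_ A)/forallP/(_ B); rewrite spl.
Qed.

Lemma P4_s_leaf_path : (exists a b c d : accessibility_graph D, is_P4 a b c d) ->
  has_s_leaf_path D.
Proof.
case=> a [b [c [d /and5P[ab bc cd nac /andP[nbd nad]]]]].
rewrite /= in a b c d ab bc cd nac nbd nad *.
have ac : a != c by apply: contraNneq nad => ->.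
have bd : b != d by apply: contraNneq nad => <-.
have ad : a != d by apply: contraNneq nac => ->; rewrite accessible_sym.
have Eab q := accessible_eq_or_adj q ab; have Ebc q := accessible_eq_or_adj q bc.
have Ecd q := accessible_eq_or_adj q cd.
have inC q (y : pendant D) : r q (val y) \in component q.
  by rewrite inE (connect_projr tl).
have [q1 n1] := not_accessible_proj ac nac.
have [k1 st1] := component_star (connect_projr tl _ _) (connect_projr tl _ _) n1.
have [b1 a1 c1] := star_middle st1 (inC _ _) (inC _ _) (inC _ _) (Eab q1) (Ebc q1) n1.
have [q2 n2] := not_accessible_proj bd nbd.
have [k2 st2] := component_star (connect_projr tl _ _) (connect_projr tl _ _) n2.
have [c2 b2 d2] := star_middle st2 (inC _ _) (inC _ _) (inC _ _) (Ebc q2) (Ecd q2) n2.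
(* In a common component [b] would project to the center, which is equal or adjacent to the
   projection of [d]. *)
have nq : ~~ connect (@edge D) q1 q2.
  apply: contra n2 => q12; rewrite -!(eq_proj tl _ q12) b1.
  exact: star_center_adj st1 (inC _ _).
have P y := proj_or tl y nq.
set x0 := r q1 q2 in P; set y0 := r q2 q1 in P.
have qx : connect (@edge D) q1 x0 := connect_projr tl _ _.
have qy : connect (@edge D) q2 y0 := connect_projr tl _ _.
(* Otherwise the two stars face each other through their centers, and [b] and [d] both project to
   [k1]. Let [q3] separate [a] from [d]. If [q1] sees [q3] at [k1], then [q3] sees [a] and [c] at
   one vertex, against the edge [cd]; if not, it sees [b] and [d] at one vertex, against the edge
   [ab]. *)
have ex : x0 = r q1 (val c).
  apply/eqP; rewrite eq_sym; apply: contraT => nc.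
  have e2 : k2 = y0 by rewrite -c2; case: (P (val c)) => // e; rewrite e eqxx in nc.
  have d1 : r q1 (val d) = k1.
    have -> : k1 = x0 by rewrite -b1; case: (P (val b)) => // e; rewrite e -e2 eqxx in b2.
    by case: (P (val d)) => // e; rewrite e -e2 eqxx in d2.
  have [q3 n3] := not_accessible_proj ad nad.
  have nq3 : ~~ connect (@edge D) q1 q3.
    apply: contra n3 => q13; rewrite -!(eq_proj tl _ q13) d1 (eq_or_adj_sym tl).
    exact: star_center_adj st1 (inC _ _).
  have P3 y := proj_or tl y nq3; move: n3.
  have [e|ne] := eqVneq k1 (r q1 q3).
    case: (P3 (val a)) => [ea|ea]; last by rewrite ea -e eqxx in a1.
    case: (P3 (val c)) => [ec|ec]; last by rewrite ec -e eqxx in c1.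
    by rewrite ea -ec Ecd.
  case: (P3 (val b)) => [eb|eb]; last by rewrite -eb b1 eqxx in ne.
  case: (P3 (val d)) => [ed|ed]; last by rewrite -ed d1 eqxx in ne.
  by rewrite ed -eb Eab.
have nx0 : x0 != k1 by rewrite ex.
have ey : y0 = r q2 (val b).
  by case: (P (val b)) => // e; rewrite -e b1 eqxx in nx0.
have ny0 : y0 != k2 by rewrite ey.
have [||||p w] := @proj_TT_walk _ _ _ _ tf_tree_like tf_tedge_total (inl x0) (inl y0).
- rewrite tf_connect_inl; apply: contra nq => xy.
  apply: connect_trans qx (connect_trans xy _); by rewrite (F_connect_sym tl).
- by rewrite /= -(eq_proj tl _ qx) -(proj_const tl nq qy).
- by rewrite /= -(eq_proj tl _ qy) -(proj_const tl _ qx) // (F_connect_sym tl).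
- case=> [z|? _ _]; last by rewrite /eq_or_adj eqxx.
  rewrite !tf_connect_inl eq_or_adj_inl /= => nzx nzy.
  have nz1 : ~~ connect (@edge D) z q1.
    by apply: contra nzx => /connect_trans; apply.
  have nz2 : ~~ connect (@edge D) z q2.
    by apply: contra nzy => /connect_trans; apply.
  rewrite -(proj_const tl nz1 qx) -(proj_const tl nz2 qy).
  rewrite (F_connect_sym tl) in nz1; rewrite (F_connect_sym tl) in nz2.
  have P1 t := proj_or tl t nz1; have P2 t := proj_or tl t nz2.
  (* Unless [z] lies between [q1] and [q2], it sees both at the same vertex. If it does lie between,
     it sees [q1] where it sees [b] and [q2] where it sees [c], and [b] and [c] are accessible from
     each other. *)
  have [e1|ne1] := eqVneq (r q1 z) x0; last first.
    case: (P1 q2) => [->|e]; first by rewrite /eq_or_adj eqxx.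
    by rewrite -e eqxx in ne1.
  have [e2|ne2] := eqVneq (r q2 z) y0; last first.
    case: (P2 q1) => [->|e]; first by rewrite /eq_or_adj eqxx.
    by rewrite -e eqxx in ne2.
  case: (P1 (val b)) => [<-|]; last by rewrite e1 b1 => e; rewrite e eqxx in nx0.
  by case: (P2 (val c)) => [<-|]; last by rewrite e2 c2 => e; rewrite e eqxx in ny0.
have [nxy _ _ _] := TT_walk_proj tf_tree_like w; rewrite tf_connect_inl in nxy.
have sl q k x : connect (@edge D) q x -> star_center (component q) k -> x != k -> s_leaf x.
  move=> qx' st xk; rewrite /s_leaf -(eq_component qx') /star_leaf inE qx'.
  by apply/existsP; exists k; rewrite st.
exists x0, y0, p; split.
- by rewrite (TT_walk_alternated w); case/and3P: w => _ _ /eqP.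
- exact: sl st1 nx0.
- exact: sl st2 ny0.
- apply: contra nxy => /eqP e; have : y0 \in component x0 by rewrite e inE connect0.
  by rewrite inE.
(* By [alt_walk_beyond] for the walk and its reverse, no vertex after [x0] lies in the first star
   and no vertex before [y0] in the second. *)
move=> [u v] /mem_zip_belast[ub vp]; have /and3P[wp _ _] := w.
have /and3P[wp' _ _] := TT_walk_rev (@tf_tedge_sym D) (@tf_fedge_sym D) w.
have [nv _] := alt_walk_beyond tf_tree_like wp vp.
rewrite -mem_rev in ub; have [nu _] := alt_walk_beyond tf_tree_like wp' ub.
case: u v {ub vp} nu nv => [u|//] [v|//]; rewrite !tf_connect_inl /= !inE.
by move=> /negPf-> /negPf->; rewrite andbF.
Qed.
End Types.

(** * From an s-leaf-path to an induced P4 *)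

Lemma s_leaf_neighbours x : s_leaf x -> exists k l, [/\ edge k x, edge k l,
  ~~ eq_or_adj (@edge D) l x & connect (@edge D) x l].
Proof.
case/andP=> xC /existsP[k /andP[st xk]]; exists k.
have /andP[kC _] := st.
(* The second leaf [l] is any third vertex of the star besides [x] and its center [k]. *)
have /set0Pn[l] : component x :\: [set x; k] != set0.
  rewrite -card_gt0 -(ltn_add2l 2) addn0 -[X in X + _](_ : #|[set x; k]| = 2); last by rewrite cards2 xk.
  apply: leq_trans (C3 x) _.
  by rewrite -(cardsID [set x; k] (component x)) leq_add2r subset_leq_card ?subsetIr.
rewrite !inE negb_or => /andP[/andP[lx lk] xl]; exists l.
have E u v := star_edge st (u := u) (v := v).
have lC : l \in component x by rewrite inE.
by rewrite /eq_or_adj !E // eqxx (negPf lk) (negPf xk) (negPf lx).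
Qed.

Lemma s_leaf_path_P4 : has_s_leaf_path D ->
  exists a b c d : accessibility_graph D, is_P4 a b c d.
Proof.
case=> x [y [p sp]]; have [_ /s_leaf_neighbours[k1 [l1 [kx1 kl1 nl1 xl1]]]
  /s_leaf_neighbours[k2 [l2 [kx2 kl2 nl2 yl2]]] _ _] := sp.
have w := s_leaf_path_TT_walk sp; have w' := TT_walk_rev (@tf_tedge_sym D) (@tf_fedge_sym D) w.
have [g gP] := exists_representative.
have ne u v : edge u v -> u != v by move=> uv; apply: contraTneq uv => ->; rewrite edge_irr.
have xk1 : connect (@edge D) x k1 by rewrite connect1 // edge_sym.
have yk2 : connect (@edge D) y k2 by rewrite connect1 // edge_sym.
have /norP[nlx1 _] := nl1; have /norP[nlx2 _] := nl2.
(* The middle edge comes from the s-leaf-path, extended by the F-edges [k1 x] and [y k2]. The star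
   of [x] sees [g k2] and [g l2] at [x], which is not adjacent to [l1]; the star of [y] likewise
   sees [g k1] at [y], which is not adjacent to [l2]. *)
exists (g l1), (g k1), (g k2), (g l2); rewrite /is_P4 /=; apply/and5P; split.
- by rewrite accessible_representative // 1?edge_sym // connect1 // edge_sym.
- by apply: (representative_walk gP w) => //; rewrite edge_sym.
- by rewrite accessible_representative // connect1.
- apply: contra nl1 => /(accessible_eq_or_adj x).
  by rewrite (representative_proj gP xl1) (representative_far gP w yk2) ?ne.
apply/andP; split.
  apply: contra nl2 => /(accessible_eq_or_adj y).
  rewrite (representative_proj gP yl2) (representative_far gP w' xk1) ?ne //.
  by rewrite (eq_or_adj_sym tl).
apply: contra nl1 => /(accessible_eq_or_adj x).
by rewrite (representative_proj gP xl1) (representative_far gP w yl2).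
Qed.

End GraphLabelledTree.

Theorem theorem6 (G : graph) (D : mgraph) :
  connected G -> distance_hereditary G -> minimal_split_decomposition G D ->
  (has_induced G (path_graph 4) <-> has_s_leaf_path D).
Proof.
move=> Gc Gdh [sd iso types C3 _ _].
have [r tl] := split_decomposition_tree_like Gc sd.
apply: iff_trans (has_induced_P4 G) _.
apply: iff_trans (iff_sym (graph_iso_P4 iso)) _; split.
  apply: (P4_s_leaf_path tl C3 _ types).
  exact: graph_iso_local_dh iso (distance_hereditary_local Gdh).
exact: s_leaf_path_P4 tl C3.
Qed.
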